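(* Fix an integer $d\geq 1$. A typical simple random walk of length $n$ on any $d$-regular graph on $n$ vertices has a maximal load of $\Omega(\log n)$. That is: there is a constant $c=c(d)>0$ such that for every infinite sequence of $d$-regular graphs $G_n=(V_n,E_n)$ on $n$ vertices, $n\to\infty$, and every choice of starting vertices $w_0\in V_n$, if $(w_0,w_1,\dots,w_n)$ is a simple random walk of length $n$ on $G_n$ from $w_0$, then $$\Pr\left[\max_{v\in V_n}\big|\{t\in\{0,1,\dots,n\}:w_t=v\}\big|\geq c\log n\right]\to 1\quad\text{as } n\to\infty .$$
   Context: Graphs are finite, undirected and simple. The simple random walk of length $n$ on $G$ from $w_0$ is the sequence $(w_0,w_1,\dots,w_n)$ in which each $w_t$ is a uniformly chosen neighbor of $w_{t-1}$, chosen independently of the past given $w_{t-1}$. The maximal load of a walk is the maximal number of times that it visits a vertex. *)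

(* Defs.v *)
From HB Require Import structures.
From mathcomp Require Import all_boot all_order all_algebra.
From mathcomp Require Import all_classical all_reals all_analysis.

Set Implicit Arguments.
Unset Strict Implicit.
Unset Printing Implicit Defensive.

Import Order.TTheory GRing.Theory Num.Theory.
Local Open Scope classical_set_scope.
Local Open Scope ring_scope.

Record sgraph := SGraph {
  vertex :> finType;
  adj : rel vertex;
  adj_sym : symmetric adj;
  adj_irrefl : irreflexive adj }.

Definition degree (G : sgraph) (x : G) : nat := #|adj x|.

Definition regular (d : nat) (G : sgraph) : Prop :=
  forall x : G, degree x = d.

Definition srw_step (R : realType) (G : sgraph) (x y : G) : R :=
  if adj x y then (degree x)%:R^-1 else 0.

Definition history (Omega : Type) (V : Type) (w : nat -> Omega -> V)
    (h : nat -> V) (t : nat) : set Omega :=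
  [set o | forall s, (s <= t)%N -> w s o = h s].

(* Processes are indexed by nat, but only w 0, ..., w n are constrained.  The
   last clause says Pr[w_(t+1) = y | w_0 = h_0, ..., w_t = h_t] =
   srw_step h_t y whenever the conditioning event has positive probability,
   multiplied out so that no division by a null probability occurs. *)
Definition is_srw (R : realType) (d : measure_display) (Omega : measurableType d)
    (P : probability Omega R) (G : sgraph) (w0 : G) (n : nat)
    (w : nat -> Omega -> G) : Prop :=
  [/\ forall t (v : G), (t <= n)%N -> measurable (w t @^-1` [set v]),
      P (w 0%N @^-1` [set w0]) = 1%E
    & forall t (h : nat -> G) (y : G), (t < n)%N ->
        P (history w h t `&` w t.+1 @^-1` [set y]) =
        (P (history w h t) * (srw_step R (h t) y)%:E)%E].

Definition max_load (Omega : Type) (G : sgraph) (n : nat)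
    (w : nat -> Omega -> G) (o : Omega) : nat :=
  (\max_(v : G) #|[pred t : 'I_n.+1 | w t o == v]|)%N.

(* Main.v *)
Require Import Defs.
From HB Require Import structures.
From mathcomp Require Import all_boot all_order all_algebra.
From mathcomp Require Import all_classical all_reals all_analysis.

Set Implicit Arguments.
Unset Strict Implicit.
Unset Printing Implicit Defensive.

Import Order.TTheory GRing.Theory Num.Theory.
Local Open Scope classical_set_scope.
Local Open Scope ring_scope.

(** On a d-regular graph the walk is back at its current vertex two steps later
    with probability exactly 1/d, whatever its past: by symmetry of adjacency,
    each of the d neighbours to which it may move sends it back with probability
    1/d ([determined_return]).  Hence, given the past, it spends a block of 2L steps
    bouncing to and from its current vertex, visiting it L + 1 times, with
    probability exactly d^-L ([determined_bounce]).  As this does not depend on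
    the past, disjoint blocks behave like independent trials, and B of them in a
    row all fail with probability (1 - d^-L)^B ([no_bounce_prob]).

    Put a = (d+1)^L, where L is the largest integer with a^4 <= n.  Then
    2L <= a^2, so B = a^2 blocks fit into n steps, while d^-L >= 1/a; thus all
    of them fail with probability at most 1/(1+a) <= 1/(L+1)
    ([max_load_prob_ge]).  Otherwise the maximal load is at least L + 1, which
    exceeds (ln n) / (4 ln (d+1)) by maximality of L; and L tends to infinity
    with n.

    Conditioning is avoided throughout: events that depend only on w 0, ..., w t
    are finite disjoint unions of histories up to time t, and the transition
    rule is summed over these histories. *)

(** * Events determined by the first steps of a walk *)

Lemma measure_sum_fibers (R : realType) (disp : measure_display)
    (Omega : measurableType disp) (P : probability Omega R) (F : finType)
    (Z : Omega -> F) (A : set Omega) :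
  (forall f, measurable (A `&` Z @^-1` [set f])) ->
  P A = (\sum_f P (A `&` Z @^-1` [set f]))%E.
Proof.
move=> mA.
have -> : P A = P (\bigcup_(f in [set: F]) (A `&` Z @^-1` [set f])).
  congr (P _); rewrite -setI_bigcupr; apply/seteqP; split=> [ o Ao|o [] //].
  by split=> //; exists (Z o).
rewrite measure_fin_bigcup; [|exact: finite_finset| |by []]; last first.
  by move=> f g _ _ [ o [[_ /= <-] [_ /= gZ]]].
rewrite fsbig_finite; last exact: finite_finset.
apply/perm_big/uniq_perm => [||f]; rewrite ?index_enum_uniq ?fset_uniq //.
by rewrite mem_index_enum in_fset_set ?in_setT //; exact: finite_finset.
Qed.

Definition determined_by (Omega V : Type) (w : nat -> Omega -> V) (t : nat)
    (A : set Omega) : Prop :=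
  forall o o', (forall s, (s <= t)%N -> w s o = w s o') -> A o -> A o'.

(** A history records the positions as a function on all of nat; restricting it
    to the times up to t leaves finitely many, indexed by a finite type. *)
Definition trajectory (Omega : Type) (V : finType) (w : nat -> Omega -> V)
    (t : nat) (o : Omega) : {ffun 'I_t.+1 -> V} := [ffun i : 'I_t.+1 => w i o].

Lemma trajectory_fiber (Omega : Type) (V : finType) (w : nat -> Omega -> V)
    (t : nat) (f : {ffun 'I_t.+1 -> V}) :
  trajectory w t @^-1` [set f] = history w (fun s => f (inord s)) t.
Proof.
apply/seteqP; split=> o /= => [<- s st|hf].
  by rewrite ffunE inordK.
apply/ffunP => i; rewrite ffunE hf; last by rewrite -ltnS.
by rewrite inord_val.
Qed.

Lemma historyS (Omega V : Type) (w : nat -> Omega -> V) (h : nat -> V) t :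
  history w h t.+1 = history w h t `&` w t.+1 @^-1` [set h t.+1].
Proof.
apply/seteqP; split=> o /= => [ho|[ho /= hS] s].
  by split=> [s st|/=]; apply: ho => //; apply: leqW.
by rewrite leq_eqVlt => /orP[/eqP ->//|]; rewrite ltnS; apply: ho.
Qed.

Lemma measurable_history (R : realType) (disp : measure_display)
    (Omega : measurableType disp) (P : probability Omega R) (G : sgraph)
    (w0 : G) (n : nat) (w : nat -> Omega -> G) (h : nat -> G) (t : nat) :
  is_srw P w0 n w -> (t <= n)%N -> measurable (history w h t).
Proof.
move=> [mw _ _]; elim: t => [|t IH] tn.
  suff -> : history w h 0 = w 0%N @^-1` [set h 0%N] by exact: mw.
  by apply/seteqP; split=> o /= => [|ho s]; [exact|rewrite leqn0 => /eqP ->].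
by rewrite historyS; apply: measurableI; [exact/IH/ltnW|exact: mw].
Qed.

(** Histories are the atoms of the algebra of events determined up to time t. *)
Lemma determined_trajectoryI (Omega : Type) (V : finType)
    (w : nat -> Omega -> V) (t : nat) (A : set Omega)
    (f : {ffun 'I_t.+1 -> V}) :
  determined_by w t A ->
  A `&` trajectory w t @^-1` [set f] = set0 \/
  A `&` trajectory w t @^-1` [set f] = trajectory w t @^-1` [set f].
Proof.
move=> dA; have [[ o [Ao /= of_]]|nA] :=
  pselect (exists o, A o /\ trajectory w t o = f); [right|left].
  apply/setIidr => o' /= o'f; apply: dA Ao => s st.
  have := congr1 (fun g : {ffun _ -> _} => g (inord s)) (etrans of_ (esym o'f)).
  by rewrite !ffunE inordK.
by rewrite -subset0 => o [Ao /= of_]; apply: nA; exists o.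
Qed.

Lemma measurable_determined (R : realType) (disp : measure_display)
    (Omega : measurableType disp) (P : probability Omega R) (G : sgraph)
    (w0 : G) (n : nat) (w : nat -> Omega -> G) (t : nat) (A : set Omega) :
  is_srw P w0 n w -> (t <= n)%N -> determined_by w t A -> measurable A.
Proof.
move=> srw tn dA.
have -> : A = \bigcup_(f in [set: {ffun 'I_t.+1 -> G}])
    (A `&` trajectory w t @^-1` [set f]).
  rewrite -setI_bigcupr; apply/seteqP; split=> [ o Ao|o [] //].
  by split=> //; exists (trajectory w t o).
apply: fin_bigcup_measurable => [|f _]; first exact: finite_finset.
have [->|->] := determined_trajectoryI f dA; first exact: measurable0.
by rewrite trajectory_fiber; apply: measurable_history srw tn.
Qed.

Lemma determined_byW (Omega V : Type) (w : nat -> Omega -> V) s t A :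
  (s <= t)%N -> determined_by w s A -> determined_by w t A.
Proof.
by move=> st dA o o' oo'; apply: dA => r rs; apply/oo'/(leq_trans rs).
Qed.

Lemma determined_byI (Omega V : Type) (w : nat -> Omega -> V) t A B :
  determined_by w t A -> determined_by w t B -> determined_by w t (A `&` B).
Proof. by move=> dA dB o o' oo' [/(dA o o' oo') ? /(dB o o' oo') ?]. Qed.

Lemma determined_byC (Omega V : Type) (w : nat -> Omega -> V) t A :
  determined_by w t A -> determined_by w t (~` A).
Proof. by move=> dA o o' oo' nA /(dA o' o) A'; apply/nA/A' => s /oo'. Qed.

(** * The probability of returning after two steps *)

(** Summing over the intermediate position y, each of the d neighbours of h t
    contributes (1/d) * (1/d): one factor for the step to y, one for the step
    back, which symmetry of adjacency allows. *)
Lemma history_return (R : realType) (disp : measure_display)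
    (Omega : measurableType disp) (P : probability Omega R) (G : sgraph)
    (d : nat) (w0 : G) (n : nat) (w : nat -> Omega -> G) (h : nat -> G)
    (t : nat) :
  (0 < d)%N -> regular d G -> is_srw P w0 n w -> (t.+2 <= n)%N ->
  P (history w h t `&` [set o | w t.+2 o = w t o]) =
  (P (history w h t) * (d%:R^-1)%:E)%E.
Proof.
move=> d0 reg srw tn; have [mw _ step] := srw.
have -> : history w h t `&` [set o | w t.+2 o = w t o] =
    history w h t `&` w t.+2 @^-1` [set h t].
  by apply/seteqP; split=> o /= [ho] E; split=> //; move: E; rewrite (ho t).
have mh : measurable (history w h t).
  by apply: measurable_history srw _; apply/ltnW/ltnW.
rewrite (@measure_sum_fibers _ _ _ P _ (w t.+1)); last first.
  move=> y; apply: measurableI; last exact/mw/ltnW.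
  by apply: measurableI => //; exact: mw.
(* The transition rule applies again at time t + 1 only to a single history,
   so the intermediate position y is made part of it. *)
pose hy y s := if (s <= t)%N then h s else y.
have hyE y : history w (hy y) t = history w h t.
  by apply/seteqP; split=> o ho s st; rewrite (ho s st) /hy st.
rewrite (eq_bigr (fun y => P (history w h t) *
   (srw_step R (h t) y * srw_step R y (h t))%:E)%E); last first.
  move=> y _; rewrite setIAC.
  have -> : history w h t `&` w t.+1 @^-1` [set y] = history w (hy y) t.+1.
    by rewrite historyS hyE /hy ltnn.
  by rewrite step // historyS hyE step ?(ltnW tn) // /hy ltnn EFinM muleA.
rewrite -ge0_sume_distrr; last first.
  move=> y _; rewrite lee_fin /srw_step.
  by do 2!case: ifP => _; rewrite ?mulr0 ?mul0r ?mulr_ge0 ?invr_ge0.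
congr (_ * _)%E; rewrite sumEFin; congr EFin.
rewrite (eq_bigr (fun y =>
    if adj (h t) y then d%:R^-1 ^+ 2 else 0 : R)); last first.
  move=> y _; rewrite /srw_step (adj_sym y) !reg.
  by case: ifP; rewrite ?mulr0 ?mul0r // expr2.
rewrite -big_mkcond /= sumr_const.
have -> : #|[pred y | adj (h t) y]| = d by rewrite -(reg (h t)).
by rewrite expr2 -[LHS]mulr_natr -mulrA mulVf ?mulr1 // pnatr_eq0 -lt0n.
Qed.

(** The return probability given a history is the same for all histories, so it
    factors out of the sum over those that make up A. *)
Lemma determined_return (R : realType) (disp : measure_display)
    (Omega : measurableType disp) (P : probability Omega R) (G : sgraph)
    (d : nat) (w0 : G) (n : nat) (w : nat -> Omega -> G) (t : nat)
    (A : set Omega) :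
  (0 < d)%N -> regular d G -> is_srw P w0 n w -> (t.+2 <= n)%N ->
  determined_by w t A ->
  P (A `&` [set o | w t.+2 o = w t o]) = (P A * (d%:R^-1)%:E)%E.
Proof.
move=> d0 reg srw tn dA.
have tn' : (t <= n)%N by apply/ltnW/ltnW.
have mf f : measurable (trajectory w t @^-1` [set f]).
  by rewrite trajectory_fiber; apply: measurable_history srw tn'.
have mA := measurable_determined srw tn' dA.
have mr : measurable [set o | w t.+2 o = w t o].
  apply: (measurable_determined srw tn) => o o' /= oo' E.
  by rewrite -!oo' // !leqW.
rewrite (@measure_sum_fibers _ _ _ P _ (trajectory w t)); last first.
  by move=> f; apply: measurableI => //; apply: measurableI.
rewrite [in RHS](@measure_sum_fibers _ _ _ P _ (trajectory w t)); last first.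
  by move=> f; apply: measurableI.
rewrite ge0_sume_distrl //; apply: eq_bigr => f _.
rewrite setIAC; have [->|->] := determined_trajectoryI f dA.
  by rewrite set0I measure0 mul0e.
by rewrite trajectory_fiber (history_return _ d0 reg srw tn).
Qed.

(** * Blocks of repeated returns *)

Definition bounce (Omega V : Type) (w : nat -> Omega -> V) (t L : nat)
    : set Omega :=
  [set o | forall j, (j <= L)%N -> w (t + j.*2)%N o = w t o].

Lemma bounce_determined (Omega V : Type) (w : nat -> Omega -> V) t L :
  determined_by w (t + L.*2) (bounce w t L).
Proof.
move=> o o' oo' wo j jL; rewrite -!oo' ?leq_addr ?leq_add2l ?leq_double //.
exact: wo.
Qed.

Lemma bounceS (Omega V : Type) (w : nat -> Omega -> V) t L :
  bounce w t L.+1 =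
  bounce w t L `&` [set o | w (t + L.*2).+2 o = w (t + L.*2)%N o].
Proof.
apply/seteqP; split=> o /=.
  move=> wo; split=> [j jL|]; first exact/wo/leqW.
  by rewrite (wo L) // -(wo L.+1) // doubleS !addnS.
move=> [wo E] j; rewrite leq_eqVlt ltnS => /orP[/eqP ->|]; last exact: wo.
by rewrite doubleS !addnS E wo.
Qed.

(** Each of the L successive returns contributes a factor 1/d, since A together
    with the previous returns is determined by the time the next one starts. *)
Lemma determined_bounce (R : realType) (disp : measure_display)
    (Omega : measurableType disp) (P : probability Omega R) (G : sgraph)
    (d : nat) (w0 : G) (n : nat) (w : nat -> Omega -> G) (t L : nat)
    (A : set Omega) :
  (0 < d)%N -> regular d G -> is_srw P w0 n w -> (t + L.*2 <= n)%N ->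
  determined_by w t A ->
  P (A `&` bounce w t L) = (P A * (d%:R ^- L)%:E)%E.
Proof.
move=> d0 reg srw + dA; elim: L => [_|L IH tn].
  rewrite expr0 invr1 mule1; congr (P _); apply/setIidl => o _ j.
  by rewrite leqn0 => /eqP ->; rewrite addn0.
rewrite doubleS !addnS in tn.
rewrite bounceS setIA (determined_return d0 reg srw tn).
  by rewrite IH ?(ltnW (ltnW tn)) // -muleA -EFinM -invfM exprSr mulrC.
apply: determined_byI; last exact: bounce_determined.
by apply: determined_byW dA; apply: leq_addr.
Qed.

(** The blocks considered are the consecutive time intervals of length 2L that
    start at 0, 2L, 4L, and so on. *)
Definition no_bounce (Omega V : Type) (w : nat -> Omega -> V) (L B : nat)
    : set Omega :=
  [set o | forall i, (i < B)%N -> ~ bounce w (i * L.*2)%N L o].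

Lemma no_bounceS (Omega V : Type) (w : nat -> Omega -> V) L B :
  no_bounce w L B.+1 = no_bounce w L B `\` bounce w (B * L.*2)%N L.
Proof.
apply/seteqP; split=> o /=.
  by move=> nb; split=> [i iB|]; [exact/nb/ltnW|exact: nb].
move=> [nb nB] i; rewrite ltnS leq_eqVlt => /orP[/eqP -> //|]; exact: nb.
Qed.

Lemma no_bounce_determined (Omega V : Type) (w : nat -> Omega -> V) L B :
  determined_by w (B * L.*2) (no_bounce w L B).
Proof.
elim: B => [ o o' _ _ []//|B IH]; rewrite no_bounceS setDE mulSnr.
apply: determined_byI; first by apply: determined_byW IH; apply: leq_addr.
exact/determined_byC/bounce_determined.
Qed.

(** The failure of the earlier blocks is determined before the next one begins,
    hence multiplies the failure probability by exactly 1 - d^-L. *)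
Lemma no_bounce_prob (R : realType) (disp : measure_display)
    (Omega : measurableType disp) (P : probability Omega R) (G : sgraph)
    (d : nat) (w0 : G) (n : nat) (w : nat -> Omega -> G) (L B : nat) :
  (0 < d)%N -> regular d G -> is_srw P w0 n w -> (B * L.*2 <= n)%N ->
  P (no_bounce w L B) = ((1 - d%:R ^- L) ^+ B)%:E.
Proof.
move=> d0 reg srw; elim: B => [_|B IH Bn].
  rewrite expr0 -(@probability_setT _ _ _ P); congr (P _).
  by apply/seteqP; split.
have Bn' : (B * L.*2 <= n)%N by apply: leq_trans Bn; rewrite mulSnr leq_addr.
rewrite mulSnr in Bn.
have dN := @no_bounce_determined _ _ w L B.
have mN := measurable_determined srw Bn' dN.
transitivity (P (no_bounce w L B) -
    P (no_bounce w L B `&` bounce w (B * L.*2)%N L))%E.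
  rewrite no_bounceS; apply: measureD => //.
    exact: measurable_determined srw Bn (@bounce_determined _ _ w _ L).
  by rewrite (le_lt_trans (probability_le1 _ mN)) // ltry.
rewrite (determined_bounce d0 reg srw Bn dN) IH // -EFinM -EFinB.
by rewrite exprSr mulrBr mulr1.
Qed.

(** * The maximal load *)

Lemma max_load_determined (Omega : Type) (G : sgraph) (w : nat -> Omega -> G)
    n (A : set nat) :
  determined_by w n [set o | A (max_load n w o)].
Proof.
move=> o o' oo'; rewrite /=; suff -> : max_load n w o = max_load n w o' by [].
by apply: eq_bigr => v _; apply: eq_card => t; rewrite !inE oo' // -ltnS.
Qed.

(** The L + 1 times t, t + 2, ..., t + 2L are distinct visits to one vertex. *)
Lemma bounce_max_load (Omega : Type) (G : sgraph) (w : nat -> Omega -> G)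
    n t L o :
  (t + L.*2 <= n)%N -> bounce w t L o -> (L < max_load n w o)%N.
Proof.
move=> tn wo; apply: leq_trans (leq_bigmax (w t o)).
have lt_n (j : 'I_L.+1) : (t + j.*2 < n.+1)%N.
  by rewrite ltnS (leq_trans _ tn) // leq_add2l leq_double -ltnS.
pose f (j : 'I_L.+1) : 'I_n.+1 := Ordinal (lt_n j).
have inj_f : injective f.
  by move=> i j [] /addnI /double_inj /val_inj.
rewrite -{1}(card_ord L.+1) -(card_imset _ inj_f).
apply/subset_leq_card/fintype.subsetP => _ /imsetP[j _ ->].
by rewrite inE /= wo // -ltnS.
Qed.

(** Both 1 - p <= exp (- p) and 1 + p n <= exp (p n) are instances of the same
    tangent line bound on the exponential. *)
Lemma expr1B_le (R : realType) (p : R) n : 0 <= p <= 1 ->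
  (1 - p) ^+ n <= (1 + p *+ n)^-1.
Proof.
move=> /andP[p0 p1].
have pn0 : 0 < 1 + p *+ n by rewrite ltr_pwDl // mulrn_wge0.
apply: (@le_trans _ _ (expR (- p) ^+ n)).
  by rewrite lerXn2r ?nnegrE ?expR_ge0 ?subr_ge0 // expR_ge1Dx.
rewrite expRN exprVn -expRM_natl mulr_natl.
by rewrite lef_pV2 ?posrE ?expR_gt0 ?expR_ge1Dx.
Qed.

(** Take a ^ 2 blocks, a = (d+1) ^ L.  They use 2 L a ^ 2 <= a ^ 4 <= n steps,
    and their expected number of successes is a ^ 2 / d ^ L >= a > L. *)
Lemma max_load_prob_ge (R : realType) (disp : measure_display)
    (Omega : measurableType disp) (P : probability Omega R) (G : sgraph)
    (d : nat) (w0 : G) (n : nat) (w : nat -> Omega -> G) (L : nat) :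
  (0 < d)%N -> regular d G -> is_srw P w0 n w -> ((d.+1 ^ 4) ^ L <= n)%N ->
  ((1 - L.+1%:R^-1)%:E <= P [set o | (L < max_load n w o)%N])%E.
Proof.
move=> d0 reg srw; set a := (d.+1 ^ L)%N => an.
have La : (L < a)%N by apply: ltn_expl.
have La2 : (L.*2 <= a ^ 2)%N.
  by rewrite /a -expnM mulnC mul2n ltnW // ltn_expl.
have Bn : (a ^ 2 * L.*2 <= n)%N.
  apply: leq_trans an; rewrite -[X in (_ <= X)%N]expnM.
  rewrite [X in (_ <= _ ^ X)%N]mulnC expnM -/a.
  by rewrite -[4%N]/(2 + 2)%N expnD leq_mul2l La2 orbT.
have mL : measurable [set o | (L < max_load n w o)%N].
  apply: measurable_determined srw (leqnn n) _.
  exact: (@max_load_determined _ _ w n [set m | (L < m)%N]).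
have dN := @no_bounce_determined _ _ w L (a ^ 2).
have mN := measurable_determined srw Bn dN.
have sub : ~` no_bounce w L (a ^ 2) `<=` [set o | (L < max_load n w o)%N].
  move=> o nN; apply: contrapT => nL; apply: nN => i iB wo; apply: nL.
  apply: bounce_max_load wo; apply: leq_trans Bn.
  by rewrite -mulSnr leq_mul2r iB orbT.
apply: (@le_trans _ _ (P (~` no_bounce w L (a ^ 2)))); last first.
  by apply: le_measure; rewrite ?inE //; exact: measurableC.
rewrite probability_setC // (no_bounce_prob d0 reg srw Bn) -EFinB lee_fin.
rewrite lerD2l lerN2; apply: le_trans (expr1B_le _ _) _.
  rewrite invr_ge0 exprn_ge0 //= invf_le1 ?exprn_gt0 ?ltr0n //.
  by rewrite exprn_ege1 // ler1n.
have da : (d ^ L <= a)%N.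
  by have [L0|L0] := posnP L; [rewrite /a L0|rewrite leq_exp2r].
(* It remains to see that L <= d ^- L * a ^ 2. *)
have dL0 : 0 < d%:R ^+ L :> R by rewrite exprn_gt0 ?ltr0n.
have pB0 : 0 < 1 + d%:R ^- L *+ (a ^ 2) :> R.
  by rewrite ltr_pwDl // mulrn_wge0 // invr_ge0 ltW.
rewrite lef_pV2 ?posrE //.
rewrite -nat1r lerD2l -[leRHS]mulr_natr mulrC ler_pdivlMr //.
rewrite -natrX -natrM ler_nat.
by rewrite -mulnn leq_mul // ltnW.
Qed.

Theorem mainTheorem5 (R : realType) (d : nat) (hd : (1 <= d)%N) :
  exists c : R, 0 < c /\
    forall (G : nat -> sgraph)
           (w0 : forall k, G k)
           (disp : nat -> measure_display)
           (Omega : forall k, measurableType (disp k))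
           (P : forall k, probability (Omega k) R)
           (w : forall k, nat -> Omega k -> G k),
      (forall k, regular d (G k)) ->
      #|G k| @[k --> \oo] --> \oo ->
      (forall k, is_srw (P k) (w0 k) #|G k| (w k)) ->
      P k [set o | c * ln (#|G k|%:R : R) <= (max_load #|G k| (w k) o)%:R]
        @[k --> \oo] --> 1%E.
Proof.
have D1 : (1 < d.+1 ^ 4)%N by rewrite -(exp1n 4) ltn_exp2r.
have lnD : 0 < ln ((d.+1 ^ 4)%:R : R) by rewrite ln_gt0 // ltr1n.
exists (ln ((d.+1 ^ 4)%:R : R))^-1; split; first by rewrite invr_gt0.
move=> G w0 disp Omega P w reg Goo srw.
pose L k := trunc_log (d.+1 ^ 4) #|G k|.
have G0 k : (0 < #|G k|)%N by apply/card_gt0P; exists (w0 k).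
have Loo : L k @[k --> \oo] --> \oo.
  apply/cvgnyPge => M; have /cvgnyPge/(_ ((d.+1 ^ 4) ^ M)%N) := Goo.
  by apply: filterS => k; apply: trunc_log_max.
have mA k : measurable
    [set o | (ln (d.+1 ^ 4)%:R)^-1 * ln (#|G k|%:R : R) <=
             (max_load #|G k| (w k) o)%:R].
  apply: measurable_determined (srw k) (leqnn _) _.
  exact: (@max_load_determined _ _ (w k) _
    [set m | (ln (d.+1 ^ 4)%:R)^-1 * ln (#|G k|%:R : R) <= m%:R]).
apply: (@squeeze_cvge _ _ _ _ (fun k => (1 - (L k).+1%:R^-1)%:E) _ (fun=> 1%E)).
- near=> k; rewrite probability_le1 // andbT.
  have GL : ((d.+1 ^ 4) ^ L k <= #|G k|)%N by apply: trunc_logP.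
  apply: le_trans (max_load_prob_ge hd (reg k) (srw k) GL) _.
  apply: le_measure; rewrite ?inE //.
    apply: measurable_determined (srw k) (leqnn _) _.
    exact: (@max_load_determined _ _ (w k) _ [set m | (L k < m)%N]).
  move=> o /= Lo; apply: (@le_trans _ _ (L k).+1%:R); last by rewrite ler_nat.
  rewrite mulrC ler_pdivrMr // mulr_natl -lnXn ?ltr0n ?expn_gt0 //.
  rewrite ler_ln ?posrE ?exprn_gt0 ?ltr0n ?expn_gt0 // -natrX ler_nat ltnW //.
  exact: trunc_log_ltn.
- apply: cvg_EFin; first by near=> k.
  rewrite -[X in _ --> X]subr0; apply: cvgB; first exact: cvg_cst.
  exact: (cvg_comp _ _ Loo (@cvg_harmonic R)).
- exact: cvg_cst.
Unshelve. all: by end_near.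
Qed.
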